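(* For every cake-division instance with $n$ agents whose social graph is a 2-Star, there exists a discrete protocol in the Robertson–Webb query model that finds a locally envy-free allocation using at most $O(n^2)$ cut queries and $O(n^3)$ evaluation queries.
   Context: The cake is $[0,1]$. Each agent $a_i$ has a valuation $v_i$ on finite unions of subintervals of $[0,1]$ that is non-negative, additive on disjoint pieces, non-atomic (for any $[x,y]$ and $\lambda\in[0,1]$ there is $y'$ with $v_i(x,y')=\lambda v_i(x,y)$), and normalized ($v_i(0,1)=1$). An allocation is a collection $\{A_1,\dots,A_n\}$ of pairwise disjoint pieces (each a finite union of intervals) whose union is $[0,1]$, with $A_i$ given to $a_i$. Given an undirected social graph $G$ on the agents, an allocation is locally envy-free if $v_i(A_i)\ge v_i(A_j)$ for every edge $(i,j)$ of $G$. In the Robertson–Webb query model the protocol accesses valuations only through cut queries $\texttt{cut}_i(x,\tau)$ (returns $y$ with $v_i(x,y)=\tau$) and evaluation queries $\texttt{eval}_i(x,y)$ (returns $v_i(x,y)$). A 2-Star is a rooted tree of depth at most two (every vertex at distance at most two from the root) in which every non-root vertex is adjacent to at most two vertices. *)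

(* Defs.v *)
From Stdlib Require Import Reals List.
From mathcomp Require Import all_boot.

Set Implicit Arguments.
Unset Strict Implicit.
Unset Printing Implicit Defensive.

Local Open Scope R_scope.

(* A valuation is given by its values v x y on intervals [x,y], 0<=x<=y<=1;
   its value on a finite union of (interior-disjoint) intervals is the sum. *)
Definition valuation (v : R -> R -> R) : Prop :=
  (forall x y, 0 <= x -> x <= y -> y <= 1 -> 0 <= v x y) /\
  (forall x y z, 0 <= x -> x <= y -> y <= z -> z <= 1 ->
      v x z = v x y + v y z) /\
  (forall x y lam, 0 <= x -> x <= y -> y <= 1 -> 0 <= lam -> lam <= 1 ->
      exists y', x <= y' /\ y' <= y /\ v x y' = lam * v x y) /\
  v 0 1 = 1.

Definition piece := list (R * R).

Definition piece_value (v : R -> R -> R) (A : piece) : R :=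
  fold_right (fun I s => v (fst I) (snd I) + s) 0 A.

(* An allocation to the agents 'I_n: every interval lies in [0,1], the
   intervals cover [0,1], and distinct intervals (of the same or different
   agents) have disjoint interiors (disjointness up to finitely many
   boundary points, which carry no value by non-atomicity). *)
Definition is_allocation (n : nat) (A : 'I_n -> piece) : Prop :=
  (forall i I, In I (A i) -> 0 <= fst I /\ fst I <= snd I /\ snd I <= 1) /\
  (forall z, 0 <= z -> z <= 1 ->
      exists i I, In I (A i) /\ fst I <= z /\ z <= snd I) /\
  (forall (i j : 'I_n) (k l : nat), (i, k) <> (j, l) ->
      (k < length (A i))%nat -> (l < length (A j))%nat ->
      forall z, ~ (fst (List.nth k (A i) (0,0)) < z /\ z < snd (List.nth k (A i) (0,0)) /\
                   fst (List.nth l (A j) (0,0)) < z /\ z < snd (List.nth l (A j) (0,0)))).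

Definition locally_envy_free (n : nat) (G : rel 'I_n)
    (v : 'I_n -> R -> R -> R) (A : 'I_n -> piece) : Prop :=
  forall i j : 'I_n, G i j -> piece_value (v i) (A i) >= piece_value (v i) (A j).

Definition simple_graph (n : nat) (G : rel 'I_n) : Prop :=
  (forall i j, G i j = G j i) /\ (forall i, G i i = false).

(* Tree: connected, with exactly n-1 edges (counted as 2(n-1) ordered pairs). *)
Definition is_tree (n : nat) (G : rel 'I_n) : Prop :=
  simple_graph G /\
  (forall i j : 'I_n, connect G i j) /\
  #|[set p : 'I_n * 'I_n | G p.1 p.2]| = (n.-1).*2%N.

Definition two_star (n : nat) (G : rel 'I_n) : Prop :=
  is_tree G /\
  exists r : 'I_n,
    (forall u : 'I_n, u = r \/ G r u \/ exists w, G r w /\ G w u) /\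
    (forall u : 'I_n, u <> r -> (#|[set w | G u w]| <= 2)%nat).

(* A discrete protocol is a (possibly infinitely branching) query tree whose
   nodes are cut or eval queries and whose leaves output an allocation; the
   next step may depend arbitrarily on the previous answers. *)
Inductive protocol (n : nat) : Type :=
| Output (A : 'I_n -> piece)
| CutQ   (i : 'I_n) (x tau : R) (k : R -> protocol n)
| EvalQ  (i : 'I_n) (x y : R) (k : R -> protocol n).

(* [succeeds v G P c e]: on valuation profile v, every run of P (for every
   admissible answer to each cut query) asks only well-posed queries, uses at
   most c cut queries and at most e eval queries, and outputs a locally
   envy-free allocation w.r.t. G. A cut query cut_i(x,tau) is well-posed when
   0<=x<=1 and some y in [x,1] has v_i(x,y)=tau; the oracle may return any
   such y. *)
Fixpoint succeeds (n : nat) (v : 'I_n -> R -> R -> R) (G : rel 'I_n)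
    (P : protocol n) (c e : nat) {struct P} : Prop :=
  match P with
  | Output A => is_allocation A /\ locally_envy_free G v A
  | CutQ i x tau k =>
      match c with
      | O => False
      | S c' =>
          0 <= x /\ x <= 1 /\
          (exists y, x <= y /\ y <= 1 /\ v i x y = tau) /\
          (forall y, x <= y -> y <= 1 -> v i x y = tau -> succeeds v G (k y) c' e)
      end
  | EvalQ i x y k =>
      match e with
      | O => False
      | S e' => 0 <= x /\ x <= y /\ y <= 1 /\ succeeds v G (k (v i x y)) c e'
      end
  end.

(* Main.v *)
Require Import Defs.
From Stdlib Require Import Reals List.
From mathcomp Require Import all_boot all_order all_algebra.
From mathcomp Require Import perm boolp Rstruct.
From mathcomp Require Import ring lra zify.

(* Let r be the root. In a round, r cuts the current residue into n pieces of
   equal worth to r. Every child c of r picks its favourite piece among the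
   remaining ones; if c has a child d, then c also picks its second favourite
   piece B and trims its favourite A to A' with v_c(A') = v_c(B), and d takes
   the better of A' and B, leaving the other one to c. The root takes the last
   piece, and the trimmings form the next residue, worth at most half of the
   previous one to r. No round creates envy.
   After 2n + 1 rounds, some c had a trimming worth at least the final residue
   (to r) in two rounds: in each of the first n + 1 rounds the largest trimming
   is worth a 1/n share of the next residue, hence at least the final one. If
   c received the trimmed piece A' in one of these two rounds, then r does not
   envy c even when c gets the whole final residue. Otherwise d took A' in both
   rounds, and exchanging the pieces of c and d in the round where d gained less
   leaves c indifferent, d without envy, and gives A' to c. So the final residue
   can be divided between c and d alone by cut and choose.
   Each of the O(n^2) cuts splits one interval whose value is known to all
   agents, so 2n evaluations per cut keep all values known. *)

Set Implicit Arguments.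
Unset Strict Implicit.
Unset Printing Implicit Defensive.

Import Order.TTheory GRing.Theory Num.Theory.
Local Open Scope ring_scope.

Ltac perm_count :=
  let p := fresh "p" in
  apply/seq.permP => p; do 4 rewrite ?map_cat /= ?count_cat /=; clear -p; lia.

(** * The cutting game on a 2-star *)

(** Used to find a child of the root whose trimming is at least the average one of its round. *)
Lemma exists_average (F : realFieldType) (I : eqType) (l : seq I) (f : I -> F) :
  l != [::] -> exists2 c, c \in l & \sum_(i <- l) f i <= (size l)%:R * f c.
Proof.
elim: l => // a [|b l] IH _.
  by exists a; rewrite ?inE // big_seq1 mul1r.
have [//|c cl hc] := IH; rewrite big_cons.
have sizeM y : (size (a :: b :: l))%:R * y = y + (size (b :: l))%:R * y :> F.
  by rewrite [size (a :: _)]/= -addn1 natrD mulrDl mul1r addrC.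
have [fca|/ltW fac] := leP (f c) (f a).
  exists a; first by rewrite inE eqxx.
  by rewrite sizeM lerD2l (le_trans hc) // ler_wpM2l // ler0n.
exists c; first by rewrite inE cl orbT.
by rewrite sizeM lerD.
Qed.

Section Game.
Variables (F : realFieldType) (n : nat) (G : rel 'I_n).
Implicit Types (a b x y z : 'rV[F]_n) (S L : seq 'rV[F]_n) (A B X T : 'M[F]_n).
Implicit Types (m : nat) (u : 'I_n).

Definition rv_ge0 a := forall u, 0 <= a ord0 u.

Definition rows A := [seq row u A | u <- enum 'I_n].

(* A position is a list of disjoint pieces covering the cake, each given by the
   row vector of its values to the agents; [game m S] says that an envy-free
   allocation can be reached from [S] with at most [m] cuts, whatever the values
   of the two parts of each cut piece turn out to be. *)
Inductive game : nat -> seq 'rV[F]_n -> Prop :=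
| game_done m A : (forall i j, G i j -> A j i <= A i i) -> game m (rows A)
| game_perm m S S' : perm_eq S S' -> game m S' -> game m S
| game_merge m a b S : game m (a + b :: S) -> game m (a :: b :: S)
| game_zero m S : game m (0 :: S) -> game m S
| game_split m a u t S : 0 <= t <= a ord0 u ->
    (forall x y, rv_ge0 x -> rv_ge0 y -> x + y = a -> x ord0 u = t ->
       game m (x :: y :: S)) ->
    game m.+1 (a :: S).

Lemma game_mono m m' S : (m <= m')%N -> game m S -> game m' S.
Proof.
move=> le_mm' gS; elim: gS m' le_mm' => {m S}.
- by move=> m A lefA m' _; apply: game_done.
- by move=> m S S' eqS _ IH m' /IH; apply: game_perm.
- by move=> m a b S _ IH m' /IH; apply: game_merge.
- by move=> m S _ IH m' /IH; apply: game_zero.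
move=> m a u t S ht _ IH [//|m'] le_mm'.
by apply: (game_split ht) => x y hx hy exy ex; apply: IH.
Qed.

Lemma game_sum m L S : game m ((\sum_(x <- L) x) :: S) -> game m (L ++ S).
Proof.
elim: L S => [|a L IH] S; first by rewrite big_nil; apply: game_zero.
rewrite big_cons => /game_merge gS.
apply: (@game_perm _ _ (L ++ a :: S)); first by perm_count.
by apply: IH; apply: game_perm gS; perm_count.
Qed.

Lemma game_merge_rows m A B S :
  game m (rows (A + B) ++ S) -> game m (rows A ++ rows B ++ S).
Proof.
rewrite /rows; elim: (enum _) S => //= u us IH S gS.
set rA := map _ us; set rB := map _ us.
apply: (@game_perm _ _ (row u A :: row u B :: rA ++ rB ++ S)); first by perm_count.
apply: game_merge.
apply: (@game_perm _ _ (rA ++ rB ++ (row u A + row u B) :: S)); first by perm_count.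
have -> : row u A + row u B = row u (A + B) by apply/rowP => j; rewrite !mxE.
by apply: IH; apply: game_perm gS; perm_count.
Qed.

(** [delta_mx u ord0 *m x] carries [x] in row [u] and zeros elsewhere, so adding it hands the loose
    piece [x] to agent [u]. *)
Lemma game_give m A u x S :
  game m (rows (A + delta_mx u ord0 *m x) ++ S) -> game m (x :: rows A ++ S).
Proof.
have perm_rows B : perm_eq (rows B) (row u B :: [seq row i B | i <- rem u (enum 'I_n)]).
  by apply: (perm_map _ (perm_to_rem _)); rewrite mem_enum.
have rowD i : row i (A + delta_mx u ord0 *m x) = row i A + (i == u)%:R *: x.
  apply/rowP=> j; rewrite !mxE big_ord1 !mxE eqxx andbT; congr (_ + _).
move=> gS.
apply: (@game_perm _ _ (x :: row u A :: [seq row i A | i <- rem u (enum 'I_n)] ++ S)).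
  by rewrite perm_cons -cat_cons perm_cat2r.
apply: game_merge; apply: game_perm gS; rewrite -cat_cons perm_cat2r perm_sym.
apply: perm_trans (perm_rows _) _; rewrite rowD eqxx scale1r addrC.
rewrite perm_cons; apply/seq.permP => p; congr (count _ _).
apply/eq_in_map => i; rewrite mem_rem_uniq ?enum_uniq // inE => /andP[/= neq_iu _].
by rewrite rowD (negPf neq_iu) scale0r addr0.
Qed.

(** Pieces worth [q] are cut off one at a time; what remains at the end needs no cut. *)
Lemma game_divide m k a u q S :
    rv_ge0 a -> 0 <= q -> a ord0 u = k.+1%:R * q ->
    (forall L, size L = k.+1 ->
       (forall x, x \in L -> rv_ge0 x /\ x ord0 u = q) -> game m (L ++ S)) ->
  game (m + k) (a :: S).
Proof.
move=> a_ge0 q_ge0; elim: k a a_ge0 S m => [|k IH] a a_ge0 S m aq gS.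
  rewrite addn0; apply: (gS [:: a]) => // x; rewrite inE => /eqP ->.
  by split=> //; rewrite aq mul1r.
rewrite addnS; apply: (@game_split _ _ u q).
  by rewrite q_ge0 aq ler_peMl // ler1n.
move=> x y x_ge0 y_ge0 exy xq.
apply: (@game_perm _ _ (y :: x :: S)); first by perm_count.
apply: IH => //.
  have /(congr1 (fun z : 'rV_n => z ord0 u)) := exy; rewrite mxE xq aq => e.
  by apply: (addrI q); rewrite e -!natr1; ring.
move=> L sL hL; apply: (@game_perm _ _ ((x :: L) ++ S)); first by perm_count.
apply: gS => /=; first by rewrite sL.
by move=> w; rewrite inE => /orP[/eqP -> //|]; apply: hL.
Qed.

Lemma exists_favourite u L : L != [::] ->
  exists2 x, x \in L & forall y, y \in L -> y ord0 u <= x ord0 u.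
Proof.
elim: L => // a [|b L] IH _.
  by exists a; rewrite ?inE // => y; rewrite inE => /eqP ->.
have [//|x xL hx] := IH.
have [le_ax|/ltW le_xa] := leP (a ord0 u) (x ord0 u).
  exists x; first by rewrite inE xL orbT.
  by move=> y; rewrite inE => /orP[/eqP -> //|/hx].
exists a; first by rewrite inE eqxx.
move=> y; rewrite inE => /orP[/eqP -> //|/hx yx].
exact: le_trans yx le_xa.
Qed.

Lemma game_merge_flatten m (Y : nat -> 'M[F]_n) l S :
  game m (rows (\sum_(s <- l) Y s) ++ S) -> game m (flatten [seq rows (Y s) | s <- l] ++ S).
Proof.
elim: l S => [|s l IH] S /=; last first.
  rewrite big_cons => /game_merge_rows gS; rewrite -catA.
  apply: (@game_perm _ _ (flatten [seq rows (Y s) | s <- l] ++ rows (Y s) ++ S)).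
    by perm_count.
  by apply: IH; apply: game_perm gS; perm_count.
rewrite big_nil /rows; elim: (enum _) => //= u us IH gS.
by apply/IH/game_zero; rewrite -[X in X :: _](row0 _ _ u).
Qed.

(** A position does not record who holds which piece, so an exchange between two agents is free. *)
Lemma perm_rows_xrow i j A : perm_eq (rows (xrow i j A)) (rows A).
Proof.
have -> : rows (xrow i j A) = [seq row u A | u <- map (tperm i j) (enum 'I_n)].
  by rewrite -map_comp; apply: eq_map => u; apply/rowP => k; rewrite !mxE.
apply: perm_map; apply: uniq_perm; rewrite ?enum_uniq //.
  by rewrite map_inj_uniq ?enum_uniq //; apply: perm_inj.
move=> u; rewrite mem_enum; apply/mapP; exists (tperm i j u); rewrite ?mem_enum //.
by rewrite tpermK.
Qed.

Definition setrow u a X : 'M[F]_n := \matrix_i (if i == u then a else row i X).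

Lemma setrowE u a X i j : setrow u a X i j = if i == u then a ord0 j else X i j.
Proof. by rewrite mxE; case: (i == u); rewrite ?mxE. Qed.

Lemma row_setrow u a X i : row i (setrow u a X) = if i == u then a else row i X.
Proof. by rewrite rowK. Qed.

Lemma map_row_setrow u a X (us : seq 'I_n) : u \notin us ->
  [seq row i (setrow u a X) | i <- us] = [seq row i X | i <- us].
Proof.
move=> uNus; apply/eq_in_map => i ius; rewrite row_setrow.
by case: eqP ius uNus => // -> ->.
Qed.


(** * One round of the protocol *)

Section Round.
Variables (r : 'I_n) (J : pred 'I_n) (d : 'I_n -> 'I_n).

(* [r] is the root and [J] holds of the children [c] of [r] that have a child,
   [d c]. Row [u] of [X] is the piece that agent [u] gets in a round, row [c] of
   [T] the part trimmed off by [c], and [z] the piece of the root, worth [q] to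
   the root. In the last clause, either [c] or [d c] holds the trimmed piece. *)
Definition served X T q z c :=
  [/\ X c r <= q, z ord0 c <= X c c &
   J c -> [/\ rv_ge0 (row c T), T c r <= q, X (d c) c = X c c,
              X c (d c) <= X (d c) (d c) &
              X c r + T c r = q \/ X c r = q /\ X (d c) r + T c r = q]].

Lemma served_congr X X' T T' q z c :
    row c X = row c X' -> (J c -> row (d c) X = row (d c) X' /\ row c T = row c T') ->
  served X T q z c -> served X' T' q z c.
Proof.
have rowE (B B' : 'M[F]_n) i j : row i B = row i B' -> B i j = B' i j.
  by move=> /rowP/(_ j); rewrite !mxE.
move=> eX eJ [h1 h2 h3]; split; rewrite -?(rowE _ _ _ _ eX) // => Jc.
have [eXd eT] := eJ Jc; have [nT lT eq1 le1 h] := h3 Jc.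
by rewrite -eT -!(rowE _ _ _ _ eT) -!(rowE _ _ _ _ eXd).
Qed.

(** Induction along the children in their order of choice. The size of [L] leaves exactly one piece
    [z] for the root; since [z] was still available whenever a child chose, no child envies the
    root. One cut per child is budgeted. *)
Lemma game_serve m q cs L S : 0 <= q ->
    uniq (cs ++ map d (filter J cs)) ->
    size L = (size cs + size (filter J cs)).+1 ->
    (forall x, x \in L -> rv_ge0 x /\ x ord0 r = q) ->
    (forall X T z, z \in L -> (forall c, c \in cs -> served X T q z c) ->
       game m (z :: [seq row c X | c <- cs] ++ [seq row (d c) X | c <- filter J cs]
                 ++ [seq row c T | c <- filter J cs] ++ S)) ->
  game (m + size cs) (L ++ S).
Proof.
move=> q_ge0; elim: cs L S => [|c cs IH] L S /=.
  case: L => // z [|//] _ _ hL gS; rewrite addn0.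
  by apply: (gS 0 0 z); rewrite ?inE.
move=> uniqcs sL hL gS.
have Lnil : L != [::] by case: (L) sL.
have [a aL amax] := exists_favourite c Lnil.
pose L1 := rem a L.
have pL : perm_eq L (a :: L1) by rewrite perm_to_rem.
have L1L x : x \in L1 -> x \in L by apply: mem_rem.
have [a_ge0 ar] := hL a aL.
have [cNcs cNd] : c \notin cs /\ c \notin [seq d c | c <- filter J cs].
  move: uniqcs => /andP[+ _]; rewrite mem_cat negb_or => /andP[-> +].
  by case: ifP => //= _; rewrite inE negb_or => /andP[].
have dcs e : e \in cs -> J e -> d e \in [seq d c | c <- filter J cs].
  by move=> ecs Je; apply: map_f; rewrite mem_filter Je.
have sL1 : size L1 = (size cs + size (filter J (c :: cs))).+1.
  by rewrite size_rem // sL.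
rewrite /= in sL1.
case Jc: (J c) uniqcs sL1 gS => /= uniqcs sL1 gS; last first.
  (* A child without a child of its own keeps its favourite [a] whole and gives up its budgeted
     cut. *)
  apply: (@game_mono (m + size cs)); first by rewrite leq_add2l.
  apply: (@game_perm _ _ (L1 ++ a :: S)).
    apply: (perm_trans (y := (a :: L1) ++ S)); first by rewrite perm_cat2r.
    by perm_count.
  apply: IH => //; first by case/andP: uniqcs.
    by move=> x /L1L; apply: hL.
  move=> X T z zL1 hX.
  apply: (game_perm _ (gS (setrow c a X) T z (L1L _ zL1) _)).
    rewrite row_setrow eqxx map_row_setrow //.
    rewrite (eq_in_map (fun e => row (d e) (setrow c a X)) (fun e => row (d e) X) _).1.
      by perm_count.
    move=> e; rewrite mem_filter => /andP[Je ecs]; rewrite row_setrow.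
    by case: eqP => // dec; move: cNd; rewrite -dec dcs.
  move=> e; rewrite inE => /orP[/eqP -> {e}|ecs].
    by split; rewrite ?setrowE ?eqxx ?ar ?Jc //; apply/amax/L1L.
  have ec : e == c = false by apply: contraNF cNcs => /eqP <-.
  apply: served_congr (hX e ecs); first by rewrite row_setrow ec.
  move=> Je; split=> //; rewrite row_setrow; case: eqP => // dec.
  by move: cNd; rewrite -dec dcs.
have L1nil : L1 != [::] by case: (L1) sL1 => //; rewrite addnS.
have [b bL1 bmax] := exists_favourite c L1nil.
pose L2 := rem b L1.
have pL1 : perm_eq L1 (b :: L2) by rewrite perm_to_rem.
have L2L1 x : x \in L2 -> x \in L1 by apply: mem_rem.
have [b_ge0 br] := hL b (L1L _ bL1).
have : uniq (c :: d c :: cs ++ [seq d c | c <- filter J cs]).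
  by rewrite (perm_uniq (s2 := c :: cs ++ d c :: [seq d c | c <- filter J cs])) //; perm_count.
rewrite /= inE negb_or => /and3P[/andP[neq_cd _]].
rewrite mem_cat negb_or => /andP[dcNcs dcNd] uniqcs'.
rewrite addnS.
apply: (@game_perm _ _ (a :: b :: L2 ++ S)).
  rewrite -!cat_cons perm_cat2r; apply: perm_trans pL _.
  by rewrite perm_cons.
(* The trim: [x] is what is left of the favourite [a], worth as much to [c] as the second choice
   [b], and [y] is the trimming. *)
apply: (@game_split _ _ c (b ord0 c)); first by rewrite b_ge0 amax // L1L.
move=> x y x_ge0 y_ge0 exy xb.
have exyr : x ord0 r + y ord0 r = q.
  by rewrite -ar -exy mxE.
apply: (@game_perm _ _ (L2 ++ x :: y :: b :: S)); first by perm_count.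
apply: IH => //.
- by apply/eqP; rewrite -eqSS -addnS -sL1 size_rem // prednK //; case: (L1) L1nil.
- by move=> w /L2L1 /L1L; apply: hL.
move=> X T z zL2 hX.
(* [d c] takes the better of [x] and [b]; [c] is indifferent and gets the other one. *)
pose pc := if x ord0 (d c) <= b ord0 (d c) then x else b.
pose pd := if x ord0 (d c) <= b ord0 (d c) then b else x.
pose X' := setrow c pc (setrow (d c) pd X).
have dcc : d c == c = false by rewrite eq_sym; apply/negbTE.
have X'c : row c X' = pc by rewrite row_setrow eqxx.
have X'd : row (d c) X' = pd by rewrite row_setrow dcc row_setrow eqxx.
have X'E e : e != c -> e != d c -> row e X' = row e X.
  by move=> /negbTE ec /negbTE ed; rewrite !row_setrow ec ed.
have csE e : e \in cs -> e != c /\ e != d c.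
  by move=> ecs; split; [apply: contraNneq cNcs | apply: contraNneq dcNcs] => <-.
have dE e : e \in cs -> J e -> d e != c /\ d e != d c.
  move=> ecs Je; split; [apply: contraNneq cNd | apply: contraNneq dcNd] => <-; exact: dcs.
apply: (game_perm _ (gS X' (setrow c y T) z (L1L _ (L2L1 _ zL2)) _)).
  rewrite X'c X'd row_setrow eqxx.
  rewrite (eq_in_map (fun e => row e X') (fun e => row e X) cs).1; last first.
    by move=> e /csE[]; apply: X'E.
  rewrite (eq_in_map (fun e => row (d e) X') (fun e => row (d e) X) _).1; last first.
    by move=> e; rewrite mem_filter => /andP[Je ecs]; have [] := dE e ecs Je; apply: X'E.
  rewrite (map_row_setrow _ _ (us := filter J cs)); last first.
    by rewrite mem_filter negb_and cNcs orbT.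
  by rewrite /pc /pd; case: ifP => _; perm_count.
have X'cE j : X' c j = pc ord0 j by rewrite -X'c [RHS]mxE.
have X'dE j : X' (d c) j = pd ord0 j by rewrite -X'd [RHS]mxE.
move=> e; rewrite inE => /orP[/eqP -> {e}|ecs].
  have zb : z ord0 c <= b ord0 c by apply/bmax/L2L1.
  have yr := y_ge0 r; have xr := x_ge0 r.
  split; rewrite ?X'cE ?X'dE ?row_setrow ?setrowE ?eqxx.
  - by rewrite /pc; case: ifP => _; lra.
  - by rewrite /pc; case: ifP => _; rewrite ?xb.
  move=> _; split; rewrite ?X'cE ?X'dE ?row_setrow ?setrowE ?eqxx //; first lra.
  - by rewrite /pc /pd; case: ifP.
  - by rewrite /pc /pd; case: (lerP (x ord0 (d c)) (b ord0 (d c))) => [//|/ltW].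
  rewrite /pc /pd; case: ifP => _; [left|right]; lra.
have [ec ed] := csE e ecs.
apply: served_congr (hX e ecs); first by rewrite X'E.
by move=> Je; have [dec ded] := dE e ecs Je; rewrite X'E // row_setrow (negbTE ec).
Qed.

(** * Iterated rounds on the whole tree *)

Variable cs : seq 'I_n.
Hypothesis enum_tree : perm_eq (enum 'I_n) (r :: cs ++ [seq d c | c <- filter J cs]).

Definition residue T := \sum_(c <- filter J cs) row c T.

(** The entry [X r r], the worth of the root's own piece, stands in for the common worth [q] of the
    pieces cut by the root. *)
Definition round a X T :=
  n%:R * X r r = a ord0 r /\ forall c, c \in cs -> served X T (X r r) (row r X) c.

Lemma uniq_tree : uniq (r :: cs ++ [seq d c | c <- filter J cs]).
Proof. by rewrite -(perm_uniq enum_tree) enum_uniq. Qed.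

Lemma size_tree : n = (size cs + size (filter J cs)).+1.
Proof.
have := perm_size enum_tree.
by rewrite -cardT card_ord /= size_cat size_map.
Qed.

(** The pairs are disjoint and avoid the root. So fewer than n/2 pieces are trimmed in a round,
    which is why the residue halves. *)
Lemma size_pairs : ((size (filter J cs)).*2 < n)%N.
Proof. by have := size_tree; have := count_size J cs; rewrite size_filter; lia. Qed.

Lemma residue_ge0 a X T : round a X T -> rv_ge0 (residue T).
Proof.
case=> _ hX u; rewrite summxE big_seq; apply: sumr_ge0 => c.
rewrite mem_filter => /andP[Jc ccs].
by have [_ _ /(_ Jc)[]] := hX c ccs.
Qed.

(** The root makes n - 1 cuts and each child at most one, which 2n covers. *)
Lemma game_round m a S : rv_ge0 a ->
    (forall X T, round a X T -> game m (residue T :: rows X ++ S)) ->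
  game (m + n.*2) (a :: S).
Proof.
move=> a_ge0 gS; have sz := size_tree.
apply: (@game_mono (m + size cs + (size cs + size (filter J cs)))); first by lia.
pose q := a ord0 r / n%:R.
have n_gt0 : 0 < n%:R :> F by rewrite ltr0n sz.
have q_ge0 : 0 <= q by rewrite divr_ge0 // ltW.
have nq : n%:R * q = a ord0 r by rewrite mulrC divfK // gt_eqF.
have /andP[rNcs uniqcs] := uniq_tree.
apply: (game_divide (u := r) (q := q)) => //; first by rewrite -sz.
move=> L sL hL; apply: (game_serve q_ge0) => // X T z zL hX.
have Xr : row r (setrow r z X) = z by rewrite row_setrow eqxx.
have Xother i : i \in cs ++ [seq d c | c <- filter J cs] -> row i (setrow r z X) = row i X.
  by move=> ics; rewrite row_setrow; case: eqP ics rNcs => // -> ->.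
have Xrr : setrow r z X r r = q by rewrite setrowE eqxx (hL z zL).2.
have dcs e : e \in cs -> J e -> d e \in [seq d c | c <- filter J cs].
  by move=> ecs Je; apply: map_f; rewrite mem_filter Je.
have ok : round a (setrow r z X) T.
  split=> [|c ccs]; rewrite Xrr // Xr; apply: served_congr (hX c ccs).
    by rewrite Xother // mem_cat ccs.
  by move=> Jc; rewrite Xother // mem_cat dcs ?orbT.
set X' := setrow r z X in gS ok Xother Xr *.
have /(game_perm _) : game m ([seq row c T | c <- filter J cs] ++ rows X' ++ S).
  by apply: game_sum; rewrite big_map; apply: gS.
apply; have : perm_eq (rows X') (z :: [seq row c X | c <- cs] ++ [seq row (d c) X | c <- filter J cs]).
  rewrite -Xr (perm_trans (perm_map _ enum_tree)) //= perm_cons map_cat -map_comp.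
  rewrite (eq_in_map (fun c => row c X') (fun c => row c X) cs).1; last first.
    by move=> c ccs; rewrite Xother // mem_cat ccs.
  rewrite (eq_in_map _ (fun c => row (d c) X) (filter J cs)).1 // => c.
  by rewrite mem_filter => /andP[Jc ccs] /=; rewrite Xother // mem_cat dcs ?orbT.
move=> /seq.permP pX; apply/seq.permP => p; rewrite /= !count_cat (pX p) /= !count_cat.
clear; lia.
Qed.

Lemma game_rounds M m a S : rv_ge0 a ->
    (forall zs Xs Ts, zs 0%N = a ->
       (forall s, (s < M)%N -> round (zs s) (Xs s) (Ts s) /\ zs s.+1 = residue (Ts s)) ->
       game m (zs M :: flatten [seq rows (Xs s) | s <- iota 0 M] ++ S)) ->
  game (m + M * n.*2) (a :: S).
Proof.
move=> a_ge0; elim: M m => [|M IH] m gS.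
  by rewrite addn0; apply: (gS (fun=> a) (fun=> 0) (fun=> 0)).
rewrite mulSn addnA; apply: IH => zs Xs Ts as0 h.
apply: game_round => [|X T ok].
  case: M h gS => [|M] h gS; first by rewrite as0.
  by have [ok ->] := h M (ltnSn M); apply: residue_ge0 ok.
(* [upd f k v] extends the history [f] by [v] at place [k]. There is one more residue than there are
   rounds, hence [M.+1] for [zs] but [M] for [Xs] and [Ts]. *)
pose upd (U : Type) (f : nat -> U) k v s := if (s < k)%N then f s else v.
have updl (U : Type) (f : nat -> U) k v s : (s < k)%N -> upd U f k v s = f s.
  by rewrite /upd => ->.
have updr (U : Type) (f : nat -> U) k v : upd U f k v k = v by rewrite /upd ltnn.
have := gS (upd _ zs M.+1 (residue T)) (upd _ Xs M X) (upd _ Ts M T).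
rewrite updr updl // as0 => /(_ erefl) g.
apply: (game_perm _ (g _)).
  rewrite -(addn1 M) iotaD map_cat flatten_cat /= updr cats0.
  rewrite (eq_in_map (fun s => rows (upd _ Xs M X s)) (fun s => rows (Xs s)) _).1; first by perm_count.
  by move=> s; rewrite mem_iota => /andP[_ lt_s]; rewrite updl.
move=> s; rewrite ltnS leq_eqVlt => /orP[/eqP -> {s}|lt_sM].
  by rewrite !updr updl.
by have := h s lt_sM; rewrite !updl // ltnW.
Qed.

(** * Dividing the final residue *)

Hypothesis edge_tree : forall i j, G i j ->
  exists2 c, c \in cs & [\/ i = r /\ j = c, i = c /\ j = r,
                            J c /\ (i = c /\ j = d c) | J c /\ (i = d c /\ j = c)].

Definition no_envy A := forall c, c \in cs ->
  [/\ A c r <= A r r, A r c <= A c c &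
   J c -> A (d c) c <= A c c /\ A c (d c) <= A (d c) (d c)].

Lemma game_no_envy m A : no_envy A -> game m (rows A).
Proof.
move=> hA; apply: game_done => i j /edge_tree[c /hA[h1 h2 h3]].
by case=> [[-> ->]|[-> ->]|[/h3[]? ? [-> ->]]|[/h3[]? ? [-> ->]]].
Qed.

Lemma neq_root c : c \in cs -> (r == c) = false.
Proof.
by move=> ccs; apply: contraTF uniq_tree => /eqP ->; rewrite /= mem_cat ccs.
Qed.

Lemma neq_root_grandchild c : c \in cs -> J c -> (r == d c) = false.
Proof.
move=> ccs Jc; apply: contraTF uniq_tree => /eqP ->.
by rewrite /= mem_cat map_f ?orbT // mem_filter Jc.
Qed.

Lemma neq_child_grandchild c e : c \in cs -> e \in cs -> J e -> (c == d e) = false.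
Proof.
move=> ccs ecs Je; apply: contraTF uniq_tree => /eqP ce.
rewrite /= cat_uniq; apply/negP => /and4P[_ _ /hasPn/(_ c)].
by rewrite ce map_f ?mem_filter ?Je // -ce ccs => /(_ isT).
Qed.

Lemma eq_grandchild c e : c \in cs -> e \in cs -> J c -> J e -> (d c == d e) = (c == e).
Proof.
move=> ccs ecs Jc Je; apply/eqP/eqP => [|-> //] dce.
have /= /andP[_] := uniq_tree; rewrite cat_uniq => /and3P[ucs _ udcs].
have [i1 i2] : c \in filter J cs /\ e \in filter J cs by rewrite !mem_filter Jc Je.
rewrite -(nth_index c i1) -(nth_index c i2); congr nth.
apply: (uniqP (d c) udcs); rewrite ?inE ?size_map ?index_mem //.
by rewrite !(nth_map c) ?index_mem // !nth_index.
Qed.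

(** [d c] halves [a] by its own measure and [c] chooses, so neither envies the other. The root has
    no edge to [d c], and its slack towards [c] covers all of [a]. *)
Lemma game_cut_and_choose m A a c : no_envy A -> c \in cs -> J c -> rv_ge0 a ->
  A c r + a ord0 r <= A r r -> game m.+1 (a :: rows A).
Proof.
move=> hA ccs Jc a_ge0 slack.
have choose x y : rv_ge0 x -> rv_ge0 y -> x + y = a -> x ord0 (d c) = y ord0 (d c) ->
    y ord0 c <= x ord0 c -> game m (x :: y :: rows A).
  move=> x_ge0 y_ge0 exy exyd yx; rewrite -[rows A]cats0.
  apply: (@game_perm _ _ (y :: rows A ++ [:: x])); first by perm_count.
  apply: (game_give (u := d c)).
  apply: (@game_perm _ _ (x :: rows (A + delta_mx (d c) ord0 *m y) ++ [::])).
    by perm_count.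
  apply: (game_give (u := c)); rewrite cats0; apply: game_no_envy => e ecs.
  set B := A + _ + _.
  have BE i j : B i j = A i j + (i == d c)%:R * y ord0 j + (i == c)%:R * x ord0 j.
    by rewrite !mxE !big_ord1 !mxE eqxx !andbT.
  have [h1 h2 h3] := hA e ecs; have := x_ge0 r; have := y_ge0 r.
  have := x_ge0 e; have := y_ge0 e; have axy : a ord0 r = x ord0 r + y ord0 r.
    by rewrite -exy mxE.
  have rd := neq_root_grandchild ccs Jc.
  have rc := neq_root ccs; have ed := neq_child_grandchild ecs ccs Jc.
  rewrite !BE rc rd ed.
  case: (eqVneq e c) => [ec|nec] /=; last first.
    move=> *; split; [lra | lra | move=> Je].
    have [h4 h5] := h3 Je.
    have dce : (d e == c) = false by rewrite eq_sym neq_child_grandchild.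
    by rewrite eq_grandchild // dce (negbTE nec) /=; lra.
  subst e; move=> *; split; [lra | lra | move=> _].
  have [h4 h5] := h3 Jc.
  by rewrite !eqxx (eq_sym (d _)) ed /=; lra.
apply: (@game_split _ _ (d c) (a ord0 (d c) / 2)).
  by have := a_ge0 (d c); lra.
move=> x y x_ge0 y_ge0 exy xd.
have yd : y ord0 (d c) = a ord0 (d c) / 2 by rewrite -exy mxE in xd *; lra.
have [yx|/ltW xy] := leP (y ord0 c) (x ord0 c); first by apply: choose; rewrite ?xd ?yd.
apply: (@game_perm _ _ (y :: x :: rows A)); first by perm_count.
by apply: choose => //; rewrite ?xd ?yd // addrC.
Qed.

(** The margin by which [d c] does not envy [c]; an exchange of their pieces reverses its sign. *)
Definition gain X c := X (d c) (d c) - X c (d c).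

(* In round [s1], the trimmed piece goes to [c], after an exchange with [d c] if
   necessary; the gain of [d c] in round [s2] then makes up for its loss. *)
Lemma game_exchange m M zs Xs Ts a c s1 :
    (forall s, (s < M)%N -> round (zs s) (Xs s) (Ts s)) ->
    rv_ge0 a -> c \in cs -> J c -> (s1 < M)%N -> a ord0 r <= Ts s1 c r ->
    Xs s1 c r + Ts s1 c r = Xs s1 r r \/
    (Xs s1 (d c) r + Ts s1 c r = Xs s1 r r /\
     exists s2, [/\ (s2 < M)%N, s2 != s1 & gain (Xs s1) c <= gain (Xs s2) c]) ->
  game m.+1 (a :: flatten [seq rows (Xs s) | s <- iota 0 M]).
Proof.
move=> hX a_ge0 ccs Jc s1M aT h.
(* [sw] tells that [c] does not hold the trimmed piece in round [s1], so that an exchange is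
   needed. *)
pose sw := Xs s1 c r + Ts s1 c r != Xs s1 r r.
pose Y s := if sw && (s == s1) then xrow c (d c) (Xs s) else Xs s.
have YE s i j : Y s i j = Xs s (if sw && (s == s1) then tperm c (d c) i else i) j.
  by rewrite /Y; case: ifP; rewrite ?mxE.
have pY : perm_eq (flatten [seq rows (Xs s) | s <- iota 0 M])
                  (flatten [seq rows (Y s) | s <- iota 0 M]).
  elim: (iota 0 M) => //= s l IH; apply: perm_cat => //.
  by rewrite perm_sym /Y; case: ifP => // _; apply: perm_rows_xrow.
apply: (@game_perm _ _ (flatten [seq rows (Y s) | s <- iota 0 M] ++ [:: a])).
  by rewrite cats1 perm_sym perm_rcons perm_cons perm_sym.
apply: game_merge_flatten; rewrite cats1.
apply: (game_perm (S' := a :: rows (\sum_(s <- iota 0 M) Y s))).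
  by rewrite perm_rcons.
have tr : tperm c (d c) r = r.
  by apply: tpermD; rewrite eq_sym ?neq_root_grandchild ?neq_root.
have te e : e \in cs -> e != c -> tperm c (d c) e = e.
  by move=> ecs ec; apply: tpermD; rewrite eq_sym // neq_child_grandchild.
have tde e : e \in cs -> J e -> e != c -> tperm c (d c) (d e) = d e.
  move=> ecs Je ec; apply: tpermD; first by rewrite neq_child_grandchild.
  by rewrite eq_grandchild // eq_sym.
have served_s s e : s \in iota 0 M -> e \in cs ->
    served (Xs s) (Ts s) (Xs s r r) (row r (Xs s)) e.
  by rewrite mem_iota => /andP[_ /hX[_]]; apply.
have Yroot s : Y s r r = Xs s r r by rewrite YE tr if_same.
(* After the exchange, only the comparison of [d c] with [c] in round [s1] can fail. [c] values both
   pieces equally, and to the root neither is worth more than its own. *)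
have Y_ok s e : s \in iota 0 M -> e \in cs ->
   [/\ Y s e r <= Y s r r, Y s r e <= Y s e e, J e -> Y s (d e) e <= Y s e e &
     J e -> ~~ (sw && (s == s1)) || (e != c) -> Y s e (d e) <= Y s (d e) (d e)].
  move=> sM ecs; have [h1 h2 h3] := served_s s e sM ecs.
  rewrite mxE in h2.
  case: (eqVneq e c) => [ec|ec]; last first.
    rewrite !YE tr if_same te // if_same; split=> // Je.
      by rewrite tde // if_same; have [_ _ -> ] := h3 Je.
    by rewrite tde // if_same; have [_ _ _ ->] := h3 Je.
  subst e; rewrite !YE tr tpermL tpermR if_same orbF.
  have [h4 h5 h6 h7 h8] := h3 Jc.
  have h40 : 0 <= Ts s c r by have := h4 r; rewrite mxE.
  case: ifP => [/andP[sw1 /eqP ss1]|_]; split=> //; rewrite ?h6 //.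
  case: h8 => [|[_]]; last lra.
  by move: sw1; rewrite /sw -ss1 => /eqP.
apply: (game_cut_and_choose _ _ ccs Jc a_ge0).
  move=> e ecs; rewrite !summxE; split.
  - rewrite big_seq [leRHS]big_seq; apply: ler_sum => s sM.
    by have [] := Y_ok s e sM ecs.
  - rewrite big_seq [leRHS]big_seq; apply: ler_sum => s sM.
    by have [] := Y_ok s e sM ecs.
  move=> Je; split.
    rewrite big_seq [leRHS]big_seq; apply: ler_sum => s sM.
    by have [_ _ ->] := Y_ok s e sM ecs.
  case: (boolP (sw && (e == c))) => [/andP[sw1 /eqP ec]|swN]; last first.
    rewrite big_seq [leRHS]big_seq; apply: ler_sum => s sM.
    have [_ _ _ ->] // := Y_ok s e sM ecs.
    by case: (sw) swN => //= ->; rewrite orbT.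
  subst e; case: h => [/eqP h|[_ [s2 [s2M s21 g12]]]]; first by rewrite /sw h in sw1.
  (* Round [s1] contributes minus its gain and [s2] plus a gain at least as large; every other round
     contributes a nonnegative amount. *)
  rewrite -subr_ge0 -sumrB.
  have s1i : s1 \in iota 0 M by rewrite mem_iota.
  have s2i : s2 \in rem s1 (iota 0 M).
    by rewrite mem_rem_uniq ?iota_uniq // inE s21 mem_iota.
  rewrite (big_rem s1) //= (big_rem s2) //= addrA; apply: addr_ge0.
    rewrite !YE sw1 eqxx (negbTE s21) /= tpermL tpermR.
    by move: g12; rewrite /gain; lra.
  rewrite big_seq; apply: sumr_ge0 => s; rewrite rem_filter ?rem_uniq ?iota_uniq //.
  rewrite mem_filter rem_filter ?iota_uniq // mem_filter /= => /and3P[_ ss1 sM].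
  have [_ _ _ h5] := Y_ok s c sM ccs.
  by rewrite subr_ge0 h5 // (negbTE ss1) andbF.
(* The root's slack towards [c] comes from round [s1] alone, where the piece of [c] lacks a trimming
   worth at least [a]. *)
have s1i : s1 \in iota 0 M by rewrite mem_iota.
rewrite !summxE (big_rem s1) //= [leRHS](big_rem s1) //= addrAC; apply: lerD.
  rewrite Yroot YE eqxx andbT; case: (boolP sw) => [sw1|/negPn/eqP]; last lra.
  rewrite tpermL; case: h => [/eqP h|[h _]]; last lra.
  by rewrite /sw h in sw1.
rewrite big_seq [leRHS]big_seq; apply: ler_sum => s /mem_rem sM.
by have [] := Y_ok s c sM ccs.
Qed.

Lemma trim_ge0 a X T c : round a X T -> c \in cs -> J c -> 0 <= T c r.
Proof.
by move=> [_ hX] ccs Jc; have [_ _ /(_ Jc)[/(_ r)]] := hX c ccs; rewrite mxE.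
Qed.

(** Every trimming is worth at most [X r r], a 1/n share of [a], and there are fewer than n/2 of
    them. *)
Lemma halve_residue a X T : rv_ge0 a -> round a X T -> 2 * residue T ord0 r <= a ord0 r.
Proof.
move=> a_ge0 hXT; have [nX hX] := hXT; rewrite summxE.
case: (eqVneq (filter J cs) [::]) => [J0|/exists_average avg].
  by rewrite J0 big_nil mulr0 a_ge0.
have [c cJ hc] := avg _ (fun c => row c T ord0 r).
move: cJ; rewrite mem_filter => /andP[Jc ccs].
have T_ge0 := trim_ge0 hXT ccs Jc.
have [_ _ /(_ Jc)[_ TX _ _ _]] := hX c ccs.
apply: le_trans (_ : 2 * ((size (filter J cs))%:R * row c T ord0 r) <= _).
  by rewrite ler_pM2l // ltr0n.
rewrite mxE mulrA -natrM -nX; apply: ler_pM => //; rewrite ?ler0n // ler_nat.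
by rewrite mul2n ltnW // size_pairs.
Qed.

(** The first n + 1 of the 2n + 1 rounds feed the pigeonhole principle. At least n rounds follow
    each of them and shrink the residue by a factor 2^n > n. One further cut is kept for the final
    cut and choose. *)
Lemma game_tree m a : rv_ge0 a -> game (m.+1 + n.*2.+1 * n.*2) [:: a].
Proof.
move=> a_ge0; apply: game_rounds => // zs Xs Ts as0 h; rewrite cats0.
have hX s : (s < n.*2.+1)%N -> round (zs s) (Xs s) (Ts s) by move=> /h[].
have hres s : (s < n.*2.+1)%N -> zs s.+1 = residue (Ts s) by move=> /h[].
have zsge0 s : (s <= n.*2.+1)%N -> rv_ge0 (zs s).
  case: s => [|s lt_s]; first by rewrite as0.
  by rewrite hres //; apply: residue_ge0 (hX s lt_s).
case: (eqVneq (filter J cs) [::]) => [J0|/exists_average avg].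
  (* With no pairs nothing is trimmed: the final residue is zero and goes to the root. *)
  have -> : zs n.*2.+1 = 0 by rewrite hres // /residue J0 big_nil.
  apply: (@game_perm _ _ (flatten [seq rows (Xs s) | s <- iota 0 n.*2.+1] ++ [:: 0])).
    by rewrite cats1 perm_sym perm_rcons.
  apply: game_merge_flatten; set A := \sum_(s <- _) _.
  apply: (@game_perm _ _ (0 :: rows A ++ [::])); first by perm_count.
  apply: (game_give (u := r)); rewrite mulmx0 addr0 cats0.
  apply: game_no_envy => c ccs; rewrite !summxE; split.
  - rewrite big_seq [leRHS]big_seq; apply: ler_sum => s.
    by rewrite mem_iota => /andP[_ /hX[_ /(_ c ccs)[]]].
  - rewrite big_seq [leRHS]big_seq; apply: ler_sum => s.
    by rewrite mem_iota => /andP[_ /hX[_ /(_ c ccs)[]]]; rewrite mxE.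
  by move=> Jc; have := mem_filter J c cs; rewrite J0 Jc ccs.
have halve k s : (s + k <= n.*2.+1)%N ->
    2 ^+ k * zs (s + k)%N ord0 r <= zs s ord0 r.
  elim: k => [|k IH] lt_sk; first by rewrite addn0 expr0 mul1r.
  rewrite addnS in lt_sk *; apply: le_trans (IH (ltnW lt_sk)).
  rewrite exprSr -mulrA ler_pM2l ?exprn_gt0 // hres //.
  by apply: halve_residue (hX _ lt_sk); apply: zsge0; lia.
set z := zs n.*2.+1; have z_ge0 : rv_ge0 z by apply: zsge0.
have big_trim (s : 'I_n.+1) : exists c, [/\ c \in cs, J c & z ord0 r <= Ts s c r].
  have s_lt : (s < n.*2.+1)%N by have := ltn_ord s; lia.
  have [c + hc] := avg _ (fun c => row c (Ts s) ord0 r).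
  rewrite mem_filter => /andP[Jc ccs]; exists c; split=> //.
  have T_ge0 := trim_ge0 (hX s s_lt) ccs Jc.
  have n_gt0 : 0 < n%:R :> F by rewrite ltr0n size_tree.
  rewrite -(ler_pM2l n_gt0).
  (* With [t] the trimming of [c], the chain is n t >= [zs s.+1] >= 2^(2n - s) z >= n z, all
     measured by the root. *)
  apply: (@le_trans _ _ (zs s.+1 ord0 r)).
    have e : (s.+1 + (n.*2.+1 - s.+1) = n.*2.+1)%N by rewrite subnKC.
    apply: le_trans (halve (n.*2.+1 - s.+1)%N s.+1 _); last by rewrite e.
    rewrite e -/z; apply: ler_wpM2r => //.
    rewrite -natrX ler_nat; apply: leq_trans (ltnW (ltn_expl n (ltnSn 1))) _.
    by rewrite leq_exp2l //; have := ltn_ord s; lia.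
  rewrite hres // summxE; apply: le_trans hc _; rewrite mxE.
  by apply: ler_wpM2r => //; rewrite ler_nat; apply: leq_trans (ltnW size_pairs); rewrite -addnn leq_addr.
have [f hf] := fin_all_exists big_trim.
(* There are n + 1 rounds and only n agents. *)
have /injectivePn[s1 [s2 s12 fs12]] : ~~ injectiveb f.
  by apply: contraFN (ltnn n) => /injectiveP/leq_card; rewrite !card_ord.
have lt_s (s : 'I_n.+1) : (s < n.*2.+1)%N by have := ltn_ord s; lia.
have [ccs Jc T1] := hf s1; have [_ _ T2] := hf s2; rewrite -fs12 in T2.
set c := f s1 in ccs Jc T1 T2.
have [_ /(_ c ccs)[_ _ /(_ Jc)[_ _ _ _ C1]]] := hX _ (lt_s s1).
have [_ /(_ c ccs)[_ _ /(_ Jc)[_ _ _ _ C2]]] := hX _ (lt_s s2).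
case: C1 => [C1|[_ C1]].
  by apply: (game_exchange m hX z_ge0 ccs Jc (lt_s s1) T1); left.
case: C2 => [C2|[_ C2]].
  by apply: (game_exchange m hX z_ge0 ccs Jc (lt_s s2) T2); left.
have [g12|/ltW g21] := leP (gain (Xs s1) c) (gain (Xs s2) c).
  apply: (game_exchange m hX z_ge0 ccs Jc (lt_s s1) T1); right; split=> //.
  by exists s2; split; rewrite // eq_sym.
apply: (game_exchange m hX z_ge0 ccs Jc (lt_s s2) T2); right; split=> //.
by exists s1; split.
Qed.

End Round.
End Game.

(** * From the game to query protocols *)

Section Realization.
Variables (n : nat) (G : rel 'I_n).
Implicit Types (v : 'I_n -> R -> R -> R).

Lemma succeeds_mono v (P : protocol n) c c' e e' : (c <= c')%N -> (e <= e')%N ->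
  succeeds v G P c e -> succeeds v G P c' e'.
Proof.
elim: P c c' e e' => [A|i x t k IH|i x y k IH] c c' e e' //=.
  case: c c' => [|c] [|c'] //= le_c le_e [h1 [h2 [h3 h4]]]; do 3 split=> //.
  by move=> y xy y1 vy; apply: (IH y c c' e e') (h4 y xy y1 vy).
case: e e' => [|e] [|e'] //= le_c le_e [h1 [h2 [h3 h4]]]; do 3 split=> //.
exact: (IH _ c c' e e') h4.
Qed.

Fixpoint eval_all (us : seq 'I_n) (x y : R) (k : seq R -> protocol n) : protocol n :=
  if us is u :: us' then EvalQ u x y (fun a => eval_all us' x y (fun l => k (a :: l)))
  else k [::].

Lemma succeeds_eval_all v us x y k c e : 0 <= x -> x <= y -> y <= 1 ->
  succeeds v G (k [seq v u x y | u <- us]) c e ->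
  succeeds v G (eval_all us x y k) c (size us + e).
Proof.
move=> /RleP x_ge0 /RleP xy /RleP y1.
by elim: us k => //= u us IH k h; do 3 split=> //; apply: IH.
Qed.

Lemma valuation_ge0 v : (forall i, valuation (v i)) ->
  forall u x y, 0 <= x -> x <= y -> y <= 1 -> 0 <= v u x y.
Proof.
by move=> hv u x y /RleP x0 /RleP xy /RleP y1; apply/RleP; apply: (hv u).1.
Qed.

Lemma valuation_add v : (forall i, valuation (v i)) ->
  forall u x y z, 0 <= x -> x <= y -> y <= z -> z <= 1 -> v u x y + v u y z = v u x z.
Proof.
move=> hv u x y z /RleP x0 /RleP xy /RleP yz /RleP z1.
by have [_ [/(_ x y z x0 xy yz z1) -> _]] := hv u.
Qed.

Lemma valuation_cut v : (forall i, valuation (v i)) ->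
  forall u x y t, 0 <= x -> x <= y -> y <= 1 -> 0 <= t -> t <= v u x y ->
  exists z, [/\ x <= z, z <= y & v u x z = t].
Proof.
move=> hv u x y t x0 xy y1 t0 tv; have v0 := valuation_ge0 hv u x0 xy y1.
have [_ [_ [cut _]]] := hv u.
(* Non-atomicity speaks of fractions, so the fraction is [t / v u x y]. On an interval of value zero
   this quotient is zero by convention, and then [t] is zero too. *)
have [||z [/RleP xz [/RleP zy vz]]] := cut x y (t / v u x y) (elimT RleP x0) (elimT RleP xy) (elimT RleP y1).
- by apply/RleP; rewrite divr_ge0.
- apply/RleP; case: (ltrP 0 (v u x y)) => [vp|vn]; first by rewrite ler_pdivrMr ?mul1r.
  have -> : v u x y = 0 by lra.
  by rewrite invr0 mulr0 ler01.
exists z; split=> //; rewrite vz; change (t / v u x y * v u x y = t).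
by case: (eqVneq (v u x y) 0) => [v00|vN0]; [rewrite v00 mulr0; lra | rewrite divfK].
Qed.

(* An interval together with the values the agents are known to give it. *)
Definition cell := (R * R * 'rV[R]_n)%type.
Implicit Types (c : cell) (b cs : seq cell) (K : seq (seq cell)).

Definition bundle_value b : 'rV[R]_n := \sum_(c <- b) c.2.

Definition inside (z : R) c := (c.1.1 < z) && (z < c.1.2).

(** Disjointness of interiors is a count, which is invariant under permutation and also detects
    repeated cells. *)
Definition tiling cs :=
  [/\ forall c, c \in cs -> [/\ 0 <= c.1.1, c.1.1 <= c.1.2, c.1.2 <= 1 & rv_ge0 c.2],
      forall z, 0 <= z -> z <= 1 -> exists2 c, c \in cs & c.1.1 <= z <= c.1.2 &
      forall z, (count (inside z) cs <= 1)%N].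

Definition known v cs := forall c, c \in cs -> forall u, c.2 ord0 u = v u c.1.1 c.1.2.

Lemma tiling_perm cs cs' : perm_eq cs cs' -> tiling cs -> tiling cs'.
Proof.
move=> pcs [h1 h2 h3]; have mcs := perm_mem pcs; split.
- by move=> c; rewrite -mcs; apply: h1.
- by move=> z z0 z1; have [c ccs hc] := h2 z z0 z1; exists c; rewrite -?mcs.
by move=> z; rewrite -(seq.permP pcs).
Qed.

Lemma tiling_split c y w1 w2 cs : c.1.1 <= y -> y <= c.1.2 -> rv_ge0 w1 -> rv_ge0 w2 ->
  tiling (c :: cs) -> tiling ((c.1.1, y, w1) :: (y, c.1.2, w2) :: cs).
Proof.
move=> cy yc w1_ge0 w2_ge0 [h1 h2 h3]; split.
- have [c0 c12 c1 _] := h1 c (mem_head _ _).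
  move=> e; rewrite !inE => /or3P[/eqP ->|/eqP ->|ecs] /=.
  + by split=> //; lra.
  + by split=> //; lra.
  by apply: h1; rewrite inE ecs orbT.
- move=> z z0 z1; have [e + hz] := h2 z z0 z1; rewrite inE => /orP[/eqP ec|ecs].
    have [zy|/ltW yz] := leP z y.
      by exists (c.1.1, y, w1); rewrite ?inE ?eqxx //= zy andbT -ec; case/andP: hz.
    by exists (y, c.1.2, w2); rewrite ?inE ?eqxx ?orbT //= yz -ec; case/andP: hz.
  by exists e; rewrite ?inE ?ecs ?orbT.
move=> z; apply: leq_trans (h3 z); rewrite /= addnA leq_add2r /inside /=.
by case: (ltP c.1.1 z) (ltP z y) (ltP y z) (ltP z c.1.2) => [?|?] [?|?] [?|?] [?|?] //=; lra.
Qed.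

(** Walking along the bundle until the running worth to [u] reaches [t] finds the only cell to be
    cut; hence splitting a bundle costs one cut query. *)
Lemma split_cell b u t : (forall c, c \in b -> rv_ge0 c.2) -> b != [::] ->
    0 <= t -> t <= bundle_value b ord0 u ->
  exists b1 c b2, [/\ b = b1 ++ c :: b2, 0 <= t - bundle_value b1 ord0 u &
    t - bundle_value b1 ord0 u <= c.2 ord0 u].
Proof.
elim: b t => // c b IH t b_ge0 _ t0.
rewrite /bundle_value big_cons mxE -/(bundle_value b) => tb.
have [tc|ct] := leP t (c.2 ord0 u).
  by exists [::], c, b; rewrite /bundle_value big_nil mxE subr0.
have b_nil : b != [::].
  by apply: contraTneq ct => b0; rewrite b0 /bundle_value big_nil mxE in tb; lra.
have [|||b1 [e [b2 [-> h1 h2]]]] := IH (t - c.2 ord0 u) _ b_nil; try lra.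
  by move=> e eb; apply: b_ge0; rewrite inE eb orbT.
exists (c :: b1), e, b2; rewrite /bundle_value big_cons mxE -/(bundle_value b1).
by split=> //; lra.
Qed.

Definition row_of (l : seq R) : 'rV[R]_n := \row_u nth 0 l u.

Lemma row_of_map f : row_of [seq f u | u <- enum 'I_n] = \row_u f u.
Proof.
apply/rowP => u; rewrite !mxE (nth_map u) ?size_enum_ord //.
by rewrite nth_ord_enum.
Qed.

(** * From tilings to allocations *)

Lemma count_two (T : Type) (p : pred T) x0 (s : seq T) k l :
  (k < l)%N -> (l < size s)%N -> p (nth x0 s k) -> p (nth x0 s l) -> (1 < count p s)%N.
Proof.
elim: s k l => // x s IH [|k] [|l] //= lt_kl lt_ls pk pl; last first.
  by apply: leq_trans (IH k l lt_kl lt_ls pk pl) _; rewrite leq_addl.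
by rewrite pk add1n ltnS -has_count; apply/(has_nthP x0); exists l.
Qed.

Lemma leq_count_flatten (T : Type) (p : pred T) (ss : seq (seq T)) i :
  (count p (nth [::] ss i) <= count p (flatten ss))%N.
Proof.
elim: ss i => [|s ss IH] [|i] //=; rewrite count_cat ?leq_addr //.
by apply: leq_trans (IH i) _; rewrite leq_addl.
Qed.

Lemma leq_count_flatten2 (T : Type) (p : pred T) (ss : seq (seq T)) i j : (i < j)%N ->
  (count p (nth [::] ss i) + count p (nth [::] ss j) <= count p (flatten ss))%N.
Proof.
elim: ss i j => [|s ss IH] [|i] [|j] //=; rewrite count_cat => lt_ij.
  by rewrite leq_add2l leq_count_flatten.
by apply: leq_trans (IH i j lt_ij) _; rewrite leq_addl.
Qed.

Lemma In_mapP (T1 : eqType) (T2 : Type) (f : T1 -> T2) (s : seq T1) y :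
  List.In y (map f s) <-> exists2 x, x \in s & y = f x.
Proof.
elim: s => [|a s IH] /=; first by split=> // -[].
split=> [[<-|/IH[x xs ->]]|[x]]; first by exists a; rewrite ?mem_head.
  by exists x; rewrite // inE xs orbT.
rewrite inE => /orP[/eqP -> ->|xs yx]; [by left | by right; apply/IH; exists x].
Qed.

Lemma list_nth_map (T1 T2 : Type) (f : T1 -> T2) (s : seq T1) k y0 x0 :
  (k < size s)%N -> List.nth k (map f s) y0 = f (nth x0 s k).
Proof. by elim: s k => // a s IH [|k] //= lt_k; apply: IH. Qed.

Lemma list_length_size (T : Type) (s : seq T) : List.length s = size s.
Proof. by elim: s => //= a s ->. Qed.

Lemma piece_value_cells v i b : known v b ->
  piece_value (v i) [seq c.1 | c <- b] = bundle_value b ord0 i.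
Proof.
rewrite /bundle_value; elim: b => [|c b IH] kb /=; first by rewrite big_nil mxE.
rewrite big_cons mxE IH => [|e eb]; first by rewrite kb ?mem_head.
by apply: kb; rewrite inE eb orbT.
Qed.

(** Two different places whose intervals have [z] in their interiors would bring the count in
    [tiling] to two, whether they belong to one agent or to two. *)
Lemma tiling_allocation K : size K = n -> tiling (flatten K) ->
  is_allocation (fun i : 'I_n => [seq c.1 | c <- nth [::] K i]).
Proof.
move=> sK [h1 h2 h3]; split; [|split].
- move=> i I /In_mapP[c cb ->].
  have [|c0 c12 c1 _] := h1 c; last by split; [|split]; apply/RleP.
  by apply/flattenP; exists (nth [::] K i) => //; rewrite mem_nth ?sK.
- move=> z /RleP z0 /RleP z1; have [c /flattenP[b bK cb] /andP[cz zc]] := h2 z z0 z1.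
  have lt_i : (index b K < n)%N by have := bK; rewrite -index_mem sK.
  exists (Ordinal lt_i), c.1; rewrite /= nth_index //; split; last by split; apply/RleP.
  by apply/In_mapP; exists c.
move=> i j k l neq; rewrite !list_length_size !size_map => lt_k lt_l z.
pose c0 : cell := (0, 0, 0).
rewrite (list_nth_map _ _ c0 lt_k) (list_nth_map _ _ c0 lt_l).
case=> /RltP ki [/RltP ik [/RltP lj /RltP jl]].
have pk : inside z (nth c0 (nth [::] K i) k) by rewrite /inside ki ik.
have pl : inside z (nth c0 (nth [::] K j) l) by rewrite /inside lj jl.
have cnt1 i' k' : (k' < size (nth [::] K i'))%N -> inside z (nth c0 (nth [::] K i') k') ->
    (0 < count (inside z) (nth [::] K i'))%N.
  by move=> lt_k' pk'; rewrite -has_count; apply/(has_nthP c0); exists k'.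
have := h3 z; apply/negP; rewrite -ltnNge.
case: (ltngtP i j) => [ij|ji|/val_inj eij].
- apply: leq_trans (leq_count_flatten2 _ _ ij).
  exact: leq_add (cnt1 _ _ lt_k pk) (cnt1 _ _ lt_l pl).
- apply: leq_trans (leq_count_flatten2 _ _ ji).
  exact: leq_add (cnt1 _ _ lt_l pl) (cnt1 _ _ lt_k pk).
subst j; apply: leq_trans (leq_count_flatten _ _ i).
case: (ltngtP k l) => [kl|lk|kl]; last by rewrite kl in neq.
  exact: count_two kl lt_l pk pl.
exact: count_two lk lt_k pl pk.
Qed.

(** [P] is chosen before [v], from the recorded values only, so it uses nothing but query answers. A
    split becomes one cut query and 2n evaluations, of both new cells by all agents; the other moves
    only regroup cells. *)
Lemma realize m S : game G m S -> forall K, map bundle_value K = S -> tiling (flatten K) ->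
  exists P : protocol n, forall v, (forall i, valuation (v i)) -> known v (flatten K) ->
    succeeds v G P m (m * n.*2).
Proof.
elim=> {m S}.
- move=> m A lefA K KA tK; exists (Output (fun i => [seq c.1 | c <- nth [::] K i])).
  move=> v hv kK.
  have sK : size K = n by rewrite -(size_map bundle_value) KA size_map size_enum_ord.
  have vK (i : 'I_n) : bundle_value (nth [::] K i) = row i A.
    rewrite -(nth_map _ 0) ?sK // KA (nth_map i) ?size_enum_ord // nth_ord_enum //.
  have kb (i : 'I_n) : known v (nth [::] K i).
    by move=> c cb; apply: kK; apply/flattenP; exists (nth [::] K i); rewrite ?mem_nth ?sK.
  suff : succeeds v G (Output (fun i => [seq c.1 | c <- nth [::] K i])) 0 0.
    by apply: succeeds_mono.
  split; first exact: tiling_allocation.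
  move=> i j /lefA/RleP; rewrite !piece_value_cells // !vK !mxE => h.
  exact/Rle_ge.
- move=> m S S' pSS' _ IH K KS tK.
  move: pSS'; rewrite -KS perm_sym => /(perm_iotaP 0)[Is pIs S'E].
  (* Different bundles may have equal values, so the permutation is transported through indices. *)
  have pK : perm_eq K [seq nth [::] K i | i <- Is].
    rewrite size_map in pIs; rewrite perm_sym.
    apply: perm_trans (perm_map _ pIs) _.
    by rewrite map_nth_iota0 // take_size.
  have pfK := perm_flatten pK.
  have [|P hP] := IH [seq nth [::] K i | i <- Is] _ (tiling_perm pfK tK).
    rewrite S'E -map_comp; apply/eq_in_map => i iIs /=; rewrite (nth_map [::]) //.
    by move: iIs; rewrite (perm_mem pIs) mem_iota size_map.
  exists P => v hv kK; apply: hP => // c; rewrite -(perm_mem pfK); exact: kK.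
- move=> m a b S _ IH [|ka [|kb K]] // [aE bE SE] tK.
  have [||P hP] := IH ((ka ++ kb) :: K); rewrite /= -?catA //.
    by rewrite SE {1}/bundle_value big_cat /= -aE -bE.
  by exists P => v hv kK; apply: hP => //; rewrite /= -catA.
- move=> m S _ IH K KS tK; have [|//|P hP] := IH ([::] :: K); last by exists P.
  by rewrite /= KS {1}/bundle_value big_nil.
move=> m a u t S /andP[t0 ta] _ IH [|b K] // [bE SE] tK; have [h1 h2 h3] := tK.
have cell_ok c : c \in b -> [/\ 0 <= c.1.1, c.1.1 <= c.1.2, c.1.2 <= 1 & rv_ge0 c.2].
  by move=> cb; apply: h1; rewrite mem_cat cb.
case: (eqVneq b [::]) => [b0|b_nil].
  (* An empty bundle is worth zero and splits into two empty ones without any query. *)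
  rewrite b0 /bundle_value big_nil in bE; rewrite -bE mxE in ta.
  have z_ge0 : rv_ge0 (0 : 'rV[R]_n) by move=> w; rewrite mxE.
  have [||||||P hP] := IH 0 0 _ _ _ _ ([::] :: [::] :: K) => //.
  - by rewrite addr0.
  - by rewrite mxE; lra.
  - by rewrite /= SE {1 2}/bundle_value big_nil.
  - by rewrite b0 in tK.
  exists P => v hv kK; apply: (@succeeds_mono v P m _ (m * n.*2)) => //.
    by rewrite leq_mul2r leqnSn orbT.
  by apply: hP => // c cK; apply: kK; rewrite b0.
rewrite -bE in ta.
have [|b1 [c [b2 [bE' s0 sc]]]] := split_cell _ b_nil t0 ta.
  by move=> c /cell_ok[].
have [c0 c12 c1 c_ge0] : [/\ 0 <= c.1.1, c.1.1 <= c.1.2, c.1.2 <= 1 & rv_ge0 c.2].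
  by apply: cell_ok; rewrite bE' mem_cat mem_head orbT.
set s := t - _ in s0 sc.
pose newK (q : R * 'rV[R]_n * 'rV[R]_n) :=
  rcons b1 (c.1.1, q.1.1, q.1.2) :: ((q.1.1, c.1.2, q.2) :: b2) :: K.
pose newcells (q : R * 'rV[R]_n * 'rV[R]_n) :=
  (c.1.1, q.1.1, q.1.2) :: (q.1.1, c.1.2, q.2) :: b1 ++ b2 ++ flatten K.
have pnew q : perm_eq (newcells q) (flatten (newK q)).
  apply/seq.permP => p; rewrite /newcells /newK -cats1; do 4 rewrite /= ?count_cat /=.
  by clear; lia.
have pold : perm_eq (flatten (b :: K)) (c :: b1 ++ b2 ++ flatten K).
  apply/seq.permP => p; rewrite bE'; do 4 rewrite /= ?count_cat /=.
  by clear; lia.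
pose good (q : R * 'rV[R]_n * 'rV[R]_n) :=
  [/\ c.1.1 <= q.1.1 <= c.1.2, rv_ge0 q.1.2, rv_ge0 q.2, q.1.2 + q.2 = c.2 & q.1.2 ord0 u = s].
(* Continuations must be defined for all answers. Those that are not [good] cannot occur for a
   valuation agreeing with the known values, and get a dummy output. *)
have step q : exists P, good q -> forall v, (forall i, valuation (v i)) ->
    known v (flatten (newK q)) -> succeeds v G P m (m * n.*2).
  have [gq|ngq] := pselect (good q); last by exists (Output (fun=> [::])).
  case: (gq) => /andP[cq qc] q1_ge0 q2_ge0 q12 q1s.
  have sum_ge0 b' : {subset b' <= b} -> rv_ge0 (bundle_value b').
    move=> b'b w; rewrite /bundle_value summxE big_seq; apply: sumr_ge0 => e /b'b/cell_ok[_ _ _].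
    exact.
  have b1_ge0 : rv_ge0 (bundle_value b1).
    by apply: sum_ge0 => e eb; rewrite bE' mem_cat eb.
  have b2_ge0 : rv_ge0 (bundle_value b2).
    by apply: sum_ge0 => e eb; rewrite bE' mem_cat inE eb !orbT.
  have [||||||P hP] := IH (bundle_value b1 + q.1.2) (q.2 + bundle_value b2) _ _ _ _ (newK q).
  - by move=> w; rewrite mxE addr_ge0.
  - by move=> w; rewrite mxE addr_ge0.
  - rewrite -bE bE' /bundle_value big_cat big_cons /= -q12.
    by rewrite !addrA.
  - by rewrite mxE q1s /s; lra.
  - by rewrite /= SE /bundle_value -cats1 big_cat big_seq1 big_cons.
  - by apply: tiling_perm (pnew q) _; apply: tiling_split => //; apply: tiling_perm pold tK.
  by exists P.
have [Pf hPf] := choice step.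
(* The oracle may answer beyond the right end of the cell if the excess is worth nothing to [u], so
   the answer is truncated to the cell. *)
pose cont y l1 l2 := Pf (Num.min y c.1.2, row_of l1, row_of l2).
exists (CutQ u c.1.1 s (fun y => eval_all (enum 'I_n) c.1.1 (Num.min y c.1.2)
  (fun l1 => eval_all (enum 'I_n) (Num.min y c.1.2) c.1.2 (cont y l1)))) => v hv kK.
have kc w : c.2 ord0 w = v w c.1.1 c.1.2.
  by apply: kK; rewrite (perm_mem pold) mem_head.
rewrite /=; split; first exact/RleP.
split; first by apply/RleP/(le_trans c12).
split.
  have [|y [cy yc vy]] := valuation_cut hv (u := u) c0 c12 c1 s0; first by rewrite -kc.
  by exists y; split; [exact/RleP | split; [apply/RleP/(le_trans yc c1)|]].
move=> y /RleP cy /RleP y1 vy; set y' := Num.min y c.1.2.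
have cy' : c.1.1 <= y' by rewrite le_min cy c12.
have y'c : y' <= c.1.2 by rewrite ge_min lexx orbT.
have y'1 : y' <= 1 by apply: le_trans y'c c1.
have vy' : v u c.1.1 y' = s.
  rewrite /y'; case: (leP y c.1.2) => // /ltW c2y.
  have c2_ge0 : 0 <= c.1.2 by apply: le_trans c0 c12.
  have := valuation_add hv u c0 c12 c2y y1.
  have := valuation_ge0 hv u c2_ge0 c2y y1.
  by rewrite vy -kc; lra.
have -> : (m.+1 * n.*2 = size (enum 'I_n) + (size (enum 'I_n) + m * n.*2))%N.
  by rewrite size_enum_ord mulSn addnA addnn.
apply: succeeds_eval_all => //; apply: succeeds_eval_all => //.
  by apply: le_trans c0 cy'.
rewrite /cont !row_of_map; apply: hPf => //.
  split=> /=; rewrite ?mxE //; first by rewrite cy' y'c.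
  - by move=> w; rewrite mxE; apply: valuation_ge0.
  - by move=> w; rewrite mxE; apply: valuation_ge0 => //; apply: le_trans c0 cy'.
  by apply/rowP => w; rewrite !mxE [RHS]kc; apply: valuation_add.
move=> e; rewrite -(perm_mem (pnew _)) !inE => /or3P[/eqP ->|/eqP ->|eK] w /=.
- by rewrite mxE.
- by rewrite mxE.
by apply: kK; rewrite (perm_mem pold) inE eK orbT.
Qed.

End Realization.

(** * The shape of a 2-star *)

(** The n - 1 edges joining each non-root vertex to its parent already account for all edges of a
    tree. The degree bound leaves a child of the root at most one further neighbour. *)
Lemma two_star_tree n (G : rel 'I_n) : two_star G ->
  exists (r : 'I_n) (J : pred 'I_n) (d : 'I_n -> 'I_n) (cs : seq 'I_n),
    perm_eq (enum 'I_n) (r :: cs ++ [seq d c | c <- filter J cs]) /\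
    forall i j, G i j ->
      exists2 c, c \in cs & [\/ i = r /\ j = c, i = c /\ j = r,
                            J c /\ (i = c /\ j = d c) | J c /\ (i = d c /\ j = c)].
Proof.
case=> -[[Gsym Girr] [_ cardE]] [r [depth deg]].
(* [p u] is the parent of [u]: the root itself, or some neighbour of the root adjacent to [u]. *)
pose p u := if G r u then r else odflt r [pick w | G r w && G w u].
have pC u : G r u -> p u = r by rewrite /p => ->.
have pD u : u != r -> ~~ G r u -> G r (p u) /\ G (p u) u.
  move=> ur nGru; rewrite /p (negbTE nGru); case: pickP => [w /andP[]//|no].
  case: (depth u) => [ur'|[Gru|[w [Grw Gwu]]]]; first by rewrite ur' eqxx in ur.
    by rewrite Gru in nGru.
  by have := no w; rewrite Grw Gwu.
have Gp u : u != r -> G (p u) u.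
  by move=> ur; case: (boolP (G r u)) => [Gru|/(pD u ur)[] //]; rewrite pC.
pose N := [set u | u != r].
pose P1 := [set (u, p u) | u in N]; pose P2 := [set (p u, u) | u in N].
have cardN : #|N| = n.-1.
  have -> : N = ~: [set r] by apply/setP => u; rewrite !inE.
  by rewrite cardsC1 card_ord.
(* Two non-root vertices cannot be parents of each other, so each parent edge gives two distinct
   ordered pairs. *)
have P12 : P1 :&: P2 = set0.
  apply/setP => -[i j]; rewrite !inE; apply/negP => /andP[].
  case/imsetP => u; rewrite inE => ur [-> ->] /imsetP[w]; rewrite inE => wr [upw pu].
  case: (boolP (G r u)) => [/pC pur|nGru]; first by rewrite -pu pur eqxx in wr.
  have [+ _] := pD u ur nGru; rewrite pu => /pC pwr.
  by rewrite upw pwr eqxx in ur.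
have Eeq : P1 :|: P2 = [set q : 'I_n * 'I_n | G q.1 q.2].
  apply/eqP; rewrite eqEcard; apply/andP; split.
    apply/subsetP => -[i j]; rewrite !inE => /orP[] /imsetP[u]; rewrite inE => ur [-> ->] /=.
      by rewrite Gsym Gp.
    by rewrite Gp.
  rewrite cardE cardsU P12 cards0 subn0 !card_imset ?cardN ?addnn //.
    by move=> u w [_ ->].
  by move=> u w [->].
have edge i j : G i j -> (i != r /\ j = p i) \/ (j != r /\ i = p j).
  move=> Gij; have : (i, j) \in [set q : 'I_n * 'I_n | G q.1 q.2] by rewrite inE.
  by rewrite -Eeq inE => /orP[] /imsetP[u]; rewrite inE => ur [-> ->]; [left|right].
pose D c := [pred w | [&& w != r, ~~ G r w & p w == c]].
pose J := [pred c | [exists w, D c w]].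
pose d c := odflt r [pick w | D c w].
have dP c : J c -> D c (d c).
  by rewrite /J /d /= => /existsP[w Dw]; case: pickP => [w' //|/(_ w)]; rewrite Dw.
have D_unique c w w' : G r c -> D c w -> D c w' -> w = w'.
  move=> Grc /and3P[wr nGw /eqP pw] /and3P[w'r nGw' /eqP pw'].
  apply/eqP/negPn/negP => ww'.
  have cr : c <> r by move=> cr; rewrite cr Girr in Grc.
  (* The root and two distinct children would be three neighbours of [c]. *)
  have : r |: [set w; w'] \subset [set v | G c v].
    apply/subsetP => v; rewrite !inE => /or3P[] /eqP ->; first by rewrite Gsym.
      by rewrite -pw Gp.
    by rewrite -pw' Gp.
  move/subset_leq_card; rewrite cardsU1 cards2 ww' !inE negb_or ![r == _]eq_sym wr w'r /=.
  by move=> /leq_trans/(_ (deg c cr)).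
have parentD u : u != r -> ~~ G r u -> [/\ G r (p u), J (p u) & d (p u) = u].
  move=> ur nGru; have [Grp _] := pD u ur nGru.
  have Du : D (p u) u by rewrite /D /= ur nGru eqxx.
  have Jp : J (p u) by apply/existsP; exists u.
  by split=> //; apply: (D_unique (p u)); rewrite ?dP.
exists r, J, d, (enum (G r)); split.
  apply: uniq_perm; first exact: enum_uniq.
    rewrite /= mem_cat mem_enum cat_uniq enum_uniq; apply/and4P; split=> //.
    - rewrite negb_or; apply/andP; split; first by rewrite unfold_in Girr.
      apply/mapP => -[c]; rewrite mem_filter => /andP[Jc _].
      by have /and3P[/eqP + _ _] := dP c Jc => + e; rewrite -e.
    - apply/hasPn => u /mapP[c]; rewrite mem_filter => /andP[/dP/and3P[_ nG _] _] ->.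
      by rewrite mem_enum.
    rewrite map_inj_in_uniq; first by apply/filter_uniq/enum_uniq.
    move=> c c'.
    rewrite !mem_filter => /andP[/dP/and3P[_ _ /eqP pc] _].
    by move=> /andP[/dP/and3P[_ _ /eqP pc'] _] dcc'; rewrite -pc -pc' dcc'.
  move=> u; rewrite mem_enum [RHS]inE mem_cat mem_enum; apply/esym.
  case: (eqVneq u r) => //= ur; case: (boolP (G r u)) => Gru.
    by rewrite unfold_in Gru.
  have [Gp' Jp dp] := parentD u ur Gru.
  apply/orP; right; apply/mapP; exists (p u) => //.
  by rewrite mem_filter Jp mem_enum.
have half i j : i != r -> j = p i ->
   exists2 c, c \in enum (G r) & (i = c /\ j = r) \/ (J c /\ (i = d c /\ j = c)).
  move=> ir ->; case: (boolP (G r i)) => [Gri|nGri].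
    by exists i; rewrite ?mem_enum //; left; split=> //; apply: pC.
  by have [Gp' Jp dp] := parentD i ir nGri; exists (p i); rewrite ?mem_enum //; right.
move=> i j /edge[[ir /(half _ _ ir)]|[jr /(half _ _ jr)]] [c ccs h]; exists c => //.
  by case: h => h; [constructor 2 | constructor 4].
by case: h => [[-> ->]|[Jc [-> ->]]]; [constructor 1 | constructor 3].
Qed.

(** * The query bounds *)

Theorem theorem4 :
  exists C : nat,
    forall (n : nat), (0 < n)%N ->
    forall G : rel 'I_n, two_star G ->
    exists P : protocol n,
      forall v : 'I_n -> R -> R -> R,
        (forall i, valuation (v i)) ->
        succeeds v G P (C * n ^ 2)%N (C * n ^ 3)%N.
Proof.
(* There are 1 + (2n + 1) 2n <= 7 n^2 cuts, each with 2n evaluations, hence at most 14 n^3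
   evaluations. The initial values of the cake are known by normalization. *)
exists 14%N => n n_gt0 G /two_star_tree[r [J [d [cs [enum_tree edge_tree]]]]].
pose cake : 'rV[R]_n := const_mx 1.
have cake_ge0 : rv_ge0 cake by move=> u; rewrite mxE ler01.
have [||P hP] := realize (game_tree enum_tree edge_tree 0 cake_ge0) (K := [:: [:: (0, 1, cake)]]).
- by rewrite /= /bundle_value big_seq1.
- split=> /=.
  + by move=> c; rewrite inE => /eqP -> /=; split; rewrite ?ler01 ?lexx.
  + by move=> z z0 z1; exists (0, 1, cake); rewrite ?mem_head //= z0.
  by move=> z; rewrite addn0 leq_b1.
exists P => v hv; apply: (succeeds_mono _ _ (hP v hv _)); last first.
- by move=> c; rewrite inE => /eqP -> u /=; rewrite mxE; have [_ [_ [_ ->]]] := hv u.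
- rewrite expnS; nia.
rewrite expnS expn1; nia.
Qed.
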